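(* Let $\alpha>0$, $\beta>0$, $t\ge 0$, and let $w(x;t)=e^{-t/x}x^\alpha(1-x)^\beta$ on $[0,1]$. For every integer $n\ge0$, $$R_n=H_n-H_{n+1}+2n+1+\alpha+\beta=(2n+\alpha+\beta)\,\mathsf p_1(n)-(2n+2+\alpha+\beta)\,\mathsf p_1(n+1)+t+\beta,$$ where $R_n$, $H_n$ and $\mathsf p_1(n)$ (all depending on $t$) are defined in the context.
   Context: $P_n(z)=z^n+\mathsf p_1(n)z^{n-1}+\cdots$ is the monic polynomial of degree $n$ orthogonal with respect to $w(\cdot;t)$, i.e. $\int_0^1P_m(x)P_n(x)w(x;t)\,dx=h_n\delta_{m,n}$; $\mathsf p_1(0):=0$. $R_n:=\frac{\beta}{h_n}\int_0^1[P_n(y)]^2w(y;t)\frac{dy}{1-y}$. $H_n:=t\frac{d}{dt}\ln D_n(t)$ with $D_n(t)=\det\left(\int_0^1x^{i+j}w(x;t)\,dx\right)_{i,j=0}^{n-1}=\prod_{j=0}^{n-1}h_j$, where $D_0:=1$ (empty product). *)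

(* Defs.v *)
From HB Require Import structures.
From mathcomp Require Import all_boot all_order all_algebra.
From mathcomp Require Import all_classical all_reals all_analysis.
Set Implicit Arguments.
Unset Strict Implicit.
Unset Printing Implicit Defensive.
Import Order.TTheory GRing.Theory Num.Theory.
Import numFieldNormedType.Exports.
Local Open Scope classical_set_scope.
Local Open Scope ring_scope.

Definition int01 (R : realType) (f : R -> R) : R :=
  \int[@lebesgue_measure R]_(x in `[0, 1]) f x.

(* At the endpoints the conventions 0^-1 = 0 and 0 `^ a = 0 (for a != 0)
   give w(0) = w(1) = 0, also for t = 0. *)
Definition pj_weight (R : realType) (alpha beta t x : R) : R :=
  expR (- t / x) * x `^ alpha * (1 - x) `^ beta.

Definition monic_orthogonal (R : realType) (w : R -> R)
    (P : nat -> {poly R}) (h : nat -> R) : Prop :=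
  [/\ forall n, P n \is monic,
      forall n, size (P n) = n.+1
    & forall m n, int01 (fun x => (P m).[x] * (P n).[x] * w x) =
                  if m == n then h n else 0].

Definition subleading (R : realType) (P : nat -> {poly R}) (n : nat) : R :=
  if n is k.+1 then (P n)`_k else 0.

Definition hankel_det (R : realType) (w : R -> R) (n : nat) : R :=
  \det (\matrix_(i < n, j < n) int01 (fun x => x ^+ (i + j) * w x)).

(* derive1 is a two-sided derivative, but D_n(s) is only meaningful for s >= 0.
   This is harmless at t = 0: the right derivative of ln D_n there is finite
   (as alpha > 0), so that H_n(0) = 0, which is also what the factor t gives
   here whatever the value of the total operator derive1. *)
Definition pj_H (R : realType) (alpha beta : R) (n : nat) (t : R) : R :=
  t * derive1 (fun s : R => ln (hankel_det (pj_weight alpha beta s) n)) t.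

Definition pj_R (R : realType) (alpha beta t : R)
    (P : nat -> {poly R}) (h : nat -> R) (n : nat) : R :=
  beta / h n *
  int01 (fun y => (P n).[y] ^+ 2 * pj_weight alpha beta t y / (1 - y)).

(* Main.v *)
(* With J = \int P_n^2 w / x, integrating (x P_n^2 w)' over [0, 1] gives
   h_n R_n = t J + (2n + 1 + alpha + beta) h_n, and integrating
   (x (1 - x) P_n^2 w)' expresses t J by h_n, p_1(n) and p_1(n + 1): both
   integrands have the form P_n q w with deg q <= n + 1, up to the terms in
   w / x and w / (1 - x).
   The remaining point is H_n - H_{n+1} = t J / h_n.  As P_n is monic, D_n(s) is
   also the determinant of the Gram matrix of the fixed polynomials P_0, ...,
   P_{n-1} (those orthogonal for the parameter t) with respect to w(.; s); this
   matrix is diagonal at s = t, so only its diagonal entries contribute to the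
   logarithmic derivative of D_n there. *)
Require Import Defs.
From HB Require Import structures.
From mathcomp Require Import all_boot all_order all_algebra fingroup perm.
From mathcomp Require Import all_classical all_reals all_analysis.
From mathcomp Require Import measurable_realfun ring.
Set Implicit Arguments.
Unset Strict Implicit.
Unset Printing Implicit Defensive.
Import Order.TTheory GRing.Theory Num.Theory.
Import numFieldNormedType.Exports.
Local Open Scope classical_set_scope.
Local Open Scope ring_scope.

(** * Calculus and integrability on the unit interval *)

(** The running integral [G] and [F] have the same derivative inside the interval, so [G - F] is
    constant by the mean value theorem. Integrability of [f] stands in for continuity at the end
    points, because the derivative of x Q w can blow up at 1 when [beta < 1]. *)
Lemma Rintegral_derive (R : realType) (F f : R -> R) (a b : R) :
  a < b -> {within `[a, b], continuous F} ->
  (forall x, x \in `]a, b[ -> is_derive x 1 F (f x)) ->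
  {in `]a, b[, continuous f} ->
  (@lebesgue_measure R).-integrable `[a, b] (EFin \o f) ->
  \int[@lebesgue_measure R]_(x in `[a, b]) f x = F b - F a.
Proof.
move=> ab cF dF cf intf.
pose G x := \int[@lebesgue_measure R]_(y in `[a, x]) f y.
have cG : {within `[a, b], continuous G}.
  exact: (parameterized_integral_continuous (ltW ab) intf).
have Ga : G a = 0 by rewrite /G set_itv1 Rintegral_set1.
have dGF x : x \in `]a, b[ -> is_derive x 1 (G - F) 0.
  move=> xab; have := xab; rewrite in_itv/= => /andP[ax xb].
  have [dG GE] := continuous_FTC1_closed xb intf ax (cf _ xab).
  have dG' : is_derive x 1 G (f x).
    by apply: DeriveDef; [exact: dG|rewrite -derive1E; exact: GE].
  by have dF' := dF _ xab; apply: is_derive_eq (subrr (f x)).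
have cGF : {within `[a, b], continuous (G - F)}.
  by move=> x; apply: continuousB; [exact: cG|exact: cF].
have [c _] := MVT ab dGF cGF.
rewrite mul0r /= => /eqP; rewrite subr_eq0 => /eqP E.
have : G b - F b = G a - F a by exact: E.
by rewrite Ga sub0r -/(G b) => /eqP; rewrite subr_eq addrC => /eqP ->.
Qed.

Lemma is_derive_onem_powR (R : realType) (a x : R) : x < 1 ->
  is_derive x 1 (fun y : R => (1 - y) `^ a) (- (a * (1 - x) `^ (a - 1))).
Proof.
move=> x1; have x0 : 0 < 1 - x by rewrite subr_gt0.
have d1 : is_derive (1 - x) 1 (fun y : R => y `^ a) (a * (1 - x) `^ (a - 1)).
  exact: is_derive1_powR.
have d2 : is_derive x (1 : R) (fun y : R => 1 - y) (-1).
  have := is_deriveB (is_derive_cst (1 : R) x 1) (is_derive_id x 1).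
  by rewrite sub0r.
have := @is_derive1_comp _ (fun y : R => y `^ a) (fun y : R => 1 - y)
  x _ _ d1 d2.
by rewrite mulrN1.
Qed.

(** The integrand is unbounded near 1 when [b < 1]. On [0, 1 - 1/(n+1)] the antiderivative -(1-x)^b
    / b bounds the integral by 1/b, and monotone convergence carries this bound over to [0, 1[. *)
Lemma integrable_onem_powR (R : realType) (b : R) : 0 < b ->
  (@lebesgue_measure R).-integrable `[0, 1]
    (EFin \o (fun x : R => (1 - x) `^ (b - 1))).
Proof.
move=> b0; pose f (x : R) := (1 - x) `^ (b - 1).
pose F (x : R) : R := - b^-1 * (1 - x) `^ b.
have mf : measurable_fun setT f.
  apply: (measurableT_comp (measurable_powR _)) => //.
  exact: measurable_funB.
have dF (x : R) : x < 1 -> is_derive x 1 F (f x).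
  move=> x1; have d := is_derive_onem_powR b x1.
  apply: is_derive_eq.
  by rewrite /GRing.scale/= mulrNN mulKf// gt_eqF.
have df (x : R) : x < 1 -> derivable f x 1.
  by move=> x1; have d := is_derive_onem_powR (b - 1) x1.
pose E n : set R := `[0, 1 - n.+1%:R^-1]%classic.
have E1 n : 1 - n.+1%:R^-1 < 1 :> R.
  by rewrite ltrBlDr ltrDl invr_gt0.
have mono (i j : nat) : (i <= j)%N ->
    1 - i.+1%:R^-1 <= 1 - j.+1%:R^-1 :> R.
  by move=> ij; rewrite lerB// lef_pV2 ?posrE// ler_nat ltnS.
have cvgE := @ge0_nondecreasing_set_cvg_integral _ (measurableTypeR R) R
  E (EFin \o f) (@lebesgue_measure R).
have {}cvgE : (\int[@lebesgue_measure R]_(x in E i) (f x)%:E)%E @[i --> \oo]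
    --> (\int[@lebesgue_measure R]_(x in \bigcup_i E i) (f x)%:E)%E.
  apply: cvgE.
  - move=> i j ij; rewrite subsetEset => x.
    rewrite /E/= !in_itv/= => /andP[-> xi].
    exact: (le_trans xi (mono _ _ ij)).
  - by move=> i; exact: measurable_itv.
  - by move=> i; apply/measurable_EFinP; exact: measurable_funTS.
  - by move=> i x _; rewrite lee_fin powR_ge0.
have UE : \bigcup_i E i = `[0, 1[%classic.
  apply/seteqP; split => x.
    case=> i _; rewrite /E/= !in_itv/= => /andP[-> xi].
    exact: (le_lt_trans xi).
  rewrite /= in_itv/= => /andP[x0 x1].
  (* Any n with n + 1 > 1/(1-x) satisfies x <= 1 - 1/(n+1). *)
  exists (Num.truncn (1 - x)^-1) => //; rewrite /E/= in_itv/= x0/=.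
  rewrite lerBrDl -lerBrDr.
  rewrite -[leRHS]invrK lef_pV2 ?posrE ?invr_gt0 ?subr_gt0//.
  by apply/ltW/truncnS_gt.
have leE i : (\int[@lebesgue_measure R]_(x in E i) (f x)%:E <= (b^-1)%:E)%E.
  (* [E 0] is the single point 0 and is treated apart, as the fundamental theorem is applied on a
     proper interval. *)
  have [->|] := eqVneq i 0%N.
    by rewrite /E invr1 subrr set_itv1 integral_set1 lee_fin invr_ge0 ltW.
  rewrite -lt0n => i0.
  have ab : 0 < 1 - i.+1%:R^-1 :> R.
    by rewrite subr_gt0 invf_lt1// ltr1n ltnS.
  rewrite (@continuous_FTC2 _ f F)//.
  - rewrite -EFinB lee_fin /F subr0 powR1 mulr1 opprK gerDr.
    by rewrite mulNr oppr_le0 mulr_ge0 ?powR_ge0// invr_ge0 ltW.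
  - apply: derivable_within_continuous => x; rewrite in_itv/= => /andP[_ xi].
    by apply: df; exact: le_lt_trans xi _.
  - have cF (x : R) : x < 1 -> {for x, continuous F}.
      move=> /dF [d _]; apply/differentiable_continuous.
      by apply/derivable1_diffP.
    split.
    + move=> x; rewrite in_itv/= => /andP[_ xi].
      by have [] := dF x (lt_trans xi (E1 _)).
    + by apply: cvg_at_right_filter; exact: cF.
    + by apply: cvg_at_left_filter; exact: cF.
  - move=> x; rewrite in_itv/= => /andP[_ xi]; rewrite derive1E.
    by have [_] := dF x (lt_trans xi (E1 _)).
apply/integrableP; split.
  by apply/measurable_EFinP; exact: measurable_funTS.
under eq_integral do rewrite /= ger0_norm ?powR_ge0//.
apply: (@le_lt_trans _ _ (b^-1)%:E); last by rewrite ltry.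
(* Dropping the null point 1 turns the domain into the union of the [E i]. *)
rewrite -integral_itv_bndo_bndc; last first.
  by apply/measurable_EFinP; exact: measurable_funTS.
rewrite -UE.
have := cvgE; move/cvg_lim => <- //.
apply: lime_le; first by apply/cvg_ex; eexists; exact: cvgE.
by apply: nearW.
Qed.

Lemma horner_bounded01 (R : realType) (Q : {poly R}) :
  exists2 C : R, 0 <= C & forall x : R, 0 <= x <= 1 -> `|Q.[x]| <= C.
Proof.
exists (\sum_(i < size Q) `|Q`_i|); first exact: sumr_ge0.
move=> x /andP[x0 x1]; rewrite horner_coef (le_trans (ler_norm_sum _ _ _))//.
apply: ler_sum => i _; rewrite normrM ler_piMr// normrX ger0_norm//.
exact: exprn_ile1.
Qed.

Lemma measurable_horner (R : realType) (Q : {poly R}) (D : set R) :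
  measurable_fun D (horner Q).
Proof.
apply: measurable_funTS; apply: continuous_measurable_fun.
exact: continuous_horner.
Qed.

(** Measurability comes from the power function with exponent -1, which agrees with the inverse on
    [0, 1] even at 0, where both are 0 by convention. *)
Lemma measurable_inv01 (R : realType) :
  measurable_fun (`[0, 1] : set R) (fun x : R => x^-1).
Proof.
apply: (eq_measurable_fun (fun x : R => x `^ (-1))).
  by move=> x; rewrite inE/= in_itv/= => /andP[x0 _]; rewrite powR_inv1.
by apply: measurable_funTS; exact: measurable_powR.
Qed.

Lemma measurable_onem_inv01 (R : realType) :
  measurable_fun (`[0, 1] : set R) (fun x : R => (1 - x)^-1).
Proof.
apply: (eq_measurable_fun (fun x : R => (1 - x) `^ (-1))).
  move=> x; rewrite inE/= in_itv/= => /andP[_ x1].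
  by rewrite powR_inv1// subr_ge0.
apply: measurable_funTS; apply: (measurableT_comp (measurable_powR _)) => //.
exact: measurable_funB.
Qed.

Lemma measurable01 (R : realType) :
  measurable (`[0, 1] : set (measurableTypeR R)).
Proof. exact: measurable_itv. Qed.

Lemma integrable01_dominated (R : realType) (f g : R -> R) (C : R) :
  measurable_fun (`[0, 1] : set R) f ->
  (@lebesgue_measure R).-integrable `[0, 1] (EFin \o g) ->
  (forall x, 0 <= x <= 1 -> `|f x| <= C * g x) ->
  (@lebesgue_measure R).-integrable `[0, 1] (EFin \o f).
Proof.
move=> mf intg fg.
apply: (le_integrable (@measurable01 R) _ _
  (integrableZl (@measurable01 R) C intg)).
  exact/measurable_EFinP.
move=> x; rewrite /= in_itv/= => x01.
by rewrite lee_fin (le_trans (fg _ x01))// ler_norm.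
Qed.

Lemma integrable01_bounded (R : realType) (f : R -> R) (C : R) :
  measurable_fun (`[0, 1] : set R) f ->
  (forall x, 0 <= x <= 1 -> `|f x| <= C) ->
  (@lebesgue_measure R).-integrable `[0, 1] (EFin \o f).
Proof.
move=> mf fC; apply: (@integrable01_dominated _ f (cst 1) C) => //.
  apply: continuous_compact_integrable; first exact: segment_compact.
  by move=> x; exact: cvg_cst.
by move=> x x01; rewrite /= mulr1 fC.
Qed.

Lemma powR_le1 (R : realType) (a x : R) : 0 <= a -> 0 <= x <= 1 -> x `^ a <= 1.
Proof.
move=> a0 /andP[x0 x1]; apply: (@le_trans _ _ (1 `^ a)); last by rewrite powR1.
by rewrite ge0_ler_powR// nnegrE.
Qed.

Lemma expR_oppdiv_le1 (R : realType) (s x : R) :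
  0 <= s -> 0 <= x -> expR (- s / x) <= 1.
Proof. by move=> s0 x0; rewrite expR_le1 mulNr oppr_le0 divr_ge0. Qed.

(** * Bounds for the weight and integrability against polynomials *)

Section weight.
Context {R : realType}.
Variables (alpha beta : R).
Hypotheses (alpha_gt0 : 0 < alpha) (beta_gt0 : 0 < beta).

Local Notation w := (pj_weight alpha beta).

Lemma measurable_pj_weight s : measurable_fun (`[0, 1] : set R) (w s).
Proof.
rewrite /pj_weight; apply: measurable_funM; first apply: measurable_funM.
- apply: (measurableT_comp (@measurable_expR R)) => //.
  by apply: measurable_funM => //; exact: measurable_inv01.
- by apply: measurable_funTS; exact: measurable_powR.
- apply: measurable_funTS; apply: (measurableT_comp (measurable_powR _)) => //.
  exact: measurable_funB.
Qed.

Lemma pj_weight_ge0 s x : 0 <= w s x.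
Proof. by rewrite !mulr_ge0// ?expR_ge0// powR_ge0. Qed.

Lemma pj_weight_gt0 s x : 0 < x < 1 -> 0 < w s x.
Proof.
by move=> /andP[x0 x1]; rewrite !mulr_gt0 ?expR_gt0// powR_gt0// subr_gt0.
Qed.

Lemma pj_weight0 s : w s 0 = 0.
Proof. by rewrite /pj_weight powR0 ?gt_eqF// mulr0 mul0r. Qed.

Lemma pj_weight1 s : w s 1 = 0.
Proof. by rewrite /pj_weight subrr powR0 ?gt_eqF// mulr0. Qed.

(** The factor (1-x)^beta is kept so that division by 1 - x still leaves the integrable bound
    (1-x)^(beta-1). *)
Lemma pj_weight_le s x : 0 <= s -> 0 <= x <= 1 -> w s x <= (1 - x) `^ beta.
Proof.
move=> s0 x01; rewrite /pj_weight -[leRHS]mul1r ler_wpM2r ?powR_ge0//.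
case/andP: (x01) => x0 _; rewrite -[leRHS]mulr1 ler_pM ?expR_ge0 ?powR_ge0//.
  exact: expR_oppdiv_le1.
exact: powR_le1 (ltW _) x01.
Qed.

Lemma pj_weight_le1 s x : 0 <= s -> 0 <= x <= 1 -> w s x <= 1.
Proof.
move=> s0 x01; apply: (le_trans (pj_weight_le s0 x01)).
apply: (powR_le1 (ltW beta_gt0)).
by rewrite subr_ge0 gerBl andbC.
Qed.

(* [u * expR (- u) <= 1] at [u = s / x]. *)
Lemma pj_weight_div_le1 s x : 0 <= s -> 0 <= x <= 1 -> s * (w s x / x) <= 1.
Proof.
move=> s0 /andP[x0 x1]; rewrite /pj_weight.
set a := x `^ alpha; set b := (1 - x) `^ beta.
have a1 : a <= 1 by rewrite (powR_le1 (ltW alpha_gt0))// x0 x1.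
have b1 : b <= 1 by rewrite (powR_le1 (ltW beta_gt0))// subr_ge0 gerBl x0 x1.
have -> : s * (expR (- s / x) * a * b / x) = (s / x * expR (- s / x)) * (a * b).
  ring.
have ux : s / x * expR (- s / x) <= 1.
  rewrite mulNr expRN -ler_pdivlMr ?invr_gt0 ?expR_gt0// invrK mul1r.
  by rewrite (le_trans _ (expR_ge1Dx _))// lerDr.
rewrite -[leRHS]mulr1 ler_pM ?mulr_ge0 ?invr_ge0 ?expR_ge0 ?powR_ge0//.
by rewrite -[leRHS]mulr1 ler_pM ?powR_ge0.
Qed.

Lemma integrable_horner_weight s (Q : {poly R}) : 0 <= s ->
  (@lebesgue_measure R).-integrable `[0, 1] (EFin \o (fun x => Q.[x] * w s x)).
Proof.
move=> s0; have [C C0 QC] := horner_bounded01 Q.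
apply: (@integrable01_bounded _ _ C).
  apply: measurable_funM; first exact: measurable_horner.
  exact: measurable_pj_weight.
move=> x x01; rewrite normrM (ger0_norm (pj_weight_ge0 _ _)) -[leRHS]mulr1.
by rewrite ler_pM ?pj_weight_ge0 ?QC ?pj_weight_le1.
Qed.

(** With the factor [s] kept inside, [pj_weight_div_le1] makes the integrand bounded, uniformly in
    [s >= 0]. *)
Lemma integrable_horner_weight_div s (Q : {poly R}) : 0 <= s ->
  (@lebesgue_measure R).-integrable `[0, 1]
    (EFin \o (fun x => s * (Q.[x] * w s x / x))).
Proof.
move=> s0; have [C C0 QC] := horner_bounded01 Q.
apply: (@integrable01_bounded _ _ C).
  apply: measurable_funM => //.
  apply: measurable_funM; last exact: measurable_inv01.
  apply: measurable_funM; first exact: measurable_horner.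
  exact: measurable_pj_weight.
move=> x x01; rewrite -mulrA mulrCA normrM -[leRHS]mulr1.
case/andP: (x01) => x0 _.
rewrite ler_pM ?QC// ger0_norm ?pj_weight_div_le1//.
by rewrite mulr_ge0// divr_ge0// pj_weight_ge0.
Qed.

(** Here the integrand may be unbounded at 1; it is dominated by a multiple of (1-x)^(beta-1). *)
Lemma integrable_horner_weight_onem_div s (Q : {poly R}) : 0 <= s ->
  (@lebesgue_measure R).-integrable `[0, 1]
    (EFin \o (fun x => Q.[x] * w s x / (1 - x))).
Proof.
move=> s0; have [C C0 QC] := horner_bounded01 Q.
apply: (@integrable01_dominated _ _ _ C _ (integrable_onem_powR beta_gt0)).
  apply: measurable_funM; last exact: measurable_onem_inv01.
  apply: measurable_funM; first exact: measurable_horner.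
  exact: measurable_pj_weight.
move=> x x01; rewrite -mulrA normrM; case/andP: (x01) => x0 x1.
rewrite ler_pM ?QC//.
(* At x = 1 the left side is 0, so cancelling 1 - x is only required for x < 1. *)
move: x1; rewrite le_eqVlt => /predU1P[->|x1].
  by rewrite pj_weight1 mul0r normr0 powR_ge0.
have x1' : 0 < 1 - x by rewrite subr_gt0.
rewrite ger0_norm; last by rewrite divr_ge0 ?pj_weight_ge0 ?ltW.
rewrite ler_pdivrMr// [leRHS]mulrC mulr_powRB1//; last exact: ltW.
exact: pj_weight_le.
Qed.

End weight.

(** * Derivative of the weight in x and integration by parts *)

Section weight_calculus.
Context {R : realType}.
Variables (alpha beta : R).
Hypotheses (alpha_gt0 : 0 < alpha) (beta_gt0 : 0 < beta).

Local Notation w := (pj_weight alpha beta).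

Lemma is_derive_pj_weight (s x : R) : 0 < x < 1 ->
  is_derive x 1 (w s) (w s x * (s / x ^+ 2 + alpha / x - beta / (1 - x))).
Proof.
move=> /andP[x0 x1]; have x1' : 0 < 1 - x by rewrite subr_gt0.
have xn0 : x != 0 by rewrite gt_eqF.
have di : is_derive x 1 (fun y : R => - s / y) (s / x ^+ 2).
  have dV := is_deriveV (f := @id R) xn0 (is_derive_id x 1).
  have := is_deriveZ (- s) dV.
  by rewrite /GRing.scale/= mulr1 mulrNN.
have de := @is_derive1_comp R expR _ x _ _ (is_derive_expR _) di.
have da := is_derive1_powR alpha x0.
have db := is_derive_onem_powR beta x1.
have := is_deriveM (is_deriveM de da) db.
rewrite /GRing.scale/= => dw; apply: is_derive_eq dw _.
rewrite /pj_weight !fctE/=.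
(* The shifted powers become quotients, so that [field] sees a single atom for each power. *)
have -> : x `^ (alpha - 1) = x `^ alpha / x.
  by rewrite -(mulr_powRB1 (ltW x0) alpha_gt0) mulrC mulKf.
have -> : (1 - x) `^ (beta - 1) = (1 - x) `^ beta / (1 - x).
  by rewrite -(mulr_powRB1 (ltW x1') beta_gt0) mulrC mulKf// gt_eqF.
by field; rewrite xn0 gt_eqF.
Qed.

Lemma continuous_pj_weight (s x : R) : 0 < x < 1 -> {for x, continuous (w s)}.
Proof.
move=> /is_derive_pj_weight -/(_ s)[d _].
by apply/differentiable_continuous/derivable1_diffP.
Qed.

Lemma onem_powR_cvg0 : (1 - x) `^ beta @[x --> 1^'-] --> (0 : R).
Proof.
have c : 1 - x @[x --> (1 : R)^'-] --> (0 : R)^'+.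
  move=> A [e /= e0 eA]; exists e => //= x /= xe x1.
  by apply: eA; rewrite /= ?subr_gt0// sub0r normrN.
exact: cvg_comp c (powR_cvg0 beta_gt0).
Qed.

(** Only the end points need an argument. At 0 the factor x tends to 0 while Q w stays bounded by
    [C]; at 1 the bound C (1-x)^beta tends to 0. *)
Lemma continuous_id_horner_weight (s : R) (Q : {poly R}) : 0 <= s ->
  {within `[0, 1], continuous (fun x : R => x * (Q.[x] * w s x))}.
Proof.
move=> s0; have [C C0 QC] := horner_bounded01 Q.
have near01r : \forall x \near (0 : R)^'+, 0 <= x <= 1.
  near=> x; apply/andP; split; first exact/ltW.
  by near: x; apply: nbhs_right_le.
have near01l : \forall x \near (1 : R)^'-, 0 <= x <= 1.
  near=> x; apply/andP; split; last exact/ltW.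
  by near: x; apply: nbhs_left_ge.
apply/(continuous_within_itvP _ ltr01); split.
- move=> x; rewrite in_itv/= => x01; apply: cvgM; first exact: cvg_id.
  by apply: cvgM; [exact: continuous_horner|exact: continuous_pj_weight].
- rewrite mul0r; apply: norm_cvg0.
  apply: (@squeeze_cvgr _ _ _ _ (cst 0) (fun x => x * C)).
  + near=> x; rewrite normr_ge0/=.
    have x01 : 0 <= x <= 1 by near: x.
    case/andP: (x01) => x0 _; rewrite normrM (ger0_norm x0) ler_wpM2l//.
    rewrite normrM -[leRHS]mulr1 ler_pM ?QC// ger0_norm ?pj_weight_ge0//.
    exact: pj_weight_le1.
  + exact: cvg_cst.
  + have : x * C @[x --> (0 : R)] --> 0 * C by apply: cvgMl; exact: cvg_id.
    by rewrite mul0r => /cvg_at_right_filter.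
- rewrite pj_weight1// !mulr0; apply: norm_cvg0.
  apply: (@squeeze_cvgr _ _ _ _ (cst 0) (fun x => C * (1 - x) `^ beta)).
  + near=> x; rewrite normr_ge0/=.
    have x01 : 0 <= x <= 1 by near: x.
    case/andP: (x01) => x0 x1; rewrite normrM (ger0_norm x0).
    rewrite -[leRHS]mul1r ler_pM//.
    rewrite normrM ler_pM ?QC// ger0_norm ?pj_weight_ge0//.
    exact: pj_weight_le.
  + exact: cvg_cst.
  + rewrite -[X in _ --> X](mulr0 C); apply: cvgM; first exact: cvg_cst.
    exact: onem_powR_cvg0.
Unshelve. all: by end_near. Qed.

Lemma int01D (f g : R -> R) :
  (@lebesgue_measure R).-integrable `[0, 1] (EFin \o f) ->
  (@lebesgue_measure R).-integrable `[0, 1] (EFin \o g) ->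
  int01 (fun x => f x + g x) = int01 f + int01 g.
Proof. by move=> intf intg; rewrite /int01 RintegralD. Qed.

Lemma int01Z (c : R) (f : R -> R) :
  (@lebesgue_measure R).-integrable `[0, 1] (EFin \o f) ->
  int01 (fun x => c * f x) = c * int01 f.
Proof. by move=> intf; rewrite /int01 RintegralZl. Qed.

Lemma integrable01D (f g : R -> R) :
  (@lebesgue_measure R).-integrable `[0, 1] (EFin \o f) ->
  (@lebesgue_measure R).-integrable `[0, 1] (EFin \o g) ->
  (@lebesgue_measure R).-integrable `[0, 1] (EFin \o (fun x => f x + g x)).
Proof. exact: (integrableD (@measurable01 R)). Qed.

Lemma integrable01Z (c : R) (f : R -> R) :
  (@lebesgue_measure R).-integrable `[0, 1] (EFin \o f) ->
  (@lebesgue_measure R).-integrable `[0, 1] (EFin \o (fun x => c * f x)).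
Proof. exact: (integrableZl (@measurable01 R)). Qed.

(* This is [\int_0^1 (x Q w)' = 0], with [x w'/w] expanded. *)
Lemma int01_by_parts (s : R) (Q : {poly R}) : 0 <= s ->
  int01 (fun x => (Q + 'X * Q^`() + (alpha + beta) *: Q).[x] * w s x)
  + int01 (fun x => s * (Q.[x] * w s x / x))
  - beta * int01 (fun x => Q.[x] * w s x / (1 - x)) = 0.
Proof.
move=> s0.
have i1 := integrable_horner_weight alpha_gt0 beta_gt0
  (Q + 'X * Q^`() + (alpha + beta) *: Q) s0.
have i2 := integrable_horner_weight_div alpha_gt0 beta_gt0 Q s0.
have i3 := integrable_horner_weight_onem_div alpha_gt0 beta_gt0 Q s0.
rewrite -mulNr -int01Z// -int01D// -int01D//; last first.
- exact: integrable01Z.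
- exact: integrable01D.
(* [f], the sum of the three integrands, is the derivative of x Q w on the open interval. *)
set f := (X in int01 X).
have cF := @continuous_id_horner_weight s Q s0.
have dF (x : R) : x \in `]0, 1[ ->
    is_derive x 1 (fun y : R => y * (Q.[y] * w s y)) (f x).
  rewrite in_itv/= => x01; have dw := is_derive_pj_weight s x01.
  have := is_deriveM (is_derive_id x 1) (is_deriveM (is_derive_poly Q x) dw).
  rewrite /GRing.scale/= => d; apply: is_derive_eq d _.
  rewrite /f !fctE/=; move: (w s x) => W.
  rewrite !(hornerD, hornerM, hornerX, hornerZ); case/andP: x01 => x0 x1.
  by field; rewrite !gt_eqF ?subr_gt0.
have cf : {in `]0, 1[, continuous f}.
  move=> x; rewrite in_itv/= => x01; case/andP: (x01) => x0 x1.
  have cw := @continuous_pj_weight s x x01.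
  have cQw (q : {poly R}) : {for x, continuous (fun x => q.[x] * w s x)}.
    by apply: cvgM; [exact: continuous_horner|exact: cw].
  apply: cvgD; first apply: cvgD.
  - exact: cQw.
  - apply: cvgM; first exact: cvg_cst.
    by apply: cvgM; [exact: cQw|apply: cvgV; [rewrite gt_eqF|exact: cvg_id]].
  - apply: cvgM; first exact: cvg_cst.
    apply: cvgM; first exact: cQw.
    apply: cvgV; first by rewrite subr_eq0 gt_eqF.
    by apply: cvgB; [exact: cvg_cst|exact: cvg_id].
rewrite /int01 (Rintegral_derive ltr01 cF dF cf).
  (* The boundary terms vanish: at 0 through the factor x, at 1 through the weight. *)
  by rewrite mul0r pj_weight1// !mulr0 subrr.
by apply: integrable01D; [exact: integrable01D|exact: integrable01Z].
Qed.

End weight_calculus.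

(** * Positivity of the integrals and differentiation in the parameter *)

Lemma finite_set_roots (R : realType) (Q : {poly R}) : Q != 0 ->
  finite_set [set x : R | root Q x].
Proof.
move=> Q0; apply: contrapT => /(infinite_set_fset (size Q))[B BQ].
apply/negP; rewrite -ltnNge; apply: (max_poly_roots Q0).
  by apply/allP => x /BQ.
exact: finmap.fset_uniq.
Qed.

Section weight_integrals.
Context {R : realType}.
Variables (alpha beta : R).
Hypotheses (alpha_gt0 : 0 < alpha) (beta_gt0 : 0 < beta).

Local Notation w := (pj_weight alpha beta).
Local Notation mu := (@lebesgue_measure R).

(** This gives [h n > 0]. If the integral were 0, the nonnegative integrand would vanish outside a
    null set; as w > 0 on ]0, 1[, this interval would be covered by a null set and the finitely many
    roots of [Q], against its measure 1. *)
Lemma int01_horner_weight_gt0 (s : R) (Q : {poly R}) : 0 <= s -> Q != 0 ->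
  0 < int01 (fun x => (Q * Q).[x] * w s x).
Proof.
move=> s0 Q0; set f := fun x : R => (Q * Q).[x] * w s x.
have f0 x : 0 <= f x.
  by rewrite /f hornerM mulr_ge0 ?pj_weight_ge0// -expr2 sqr_ge0.
rewrite lt_neqAle Rintegral_ge0// andbT; apply/negP => /eqP f_int0.
have intf := integrable_horner_weight alpha_gt0 beta_gt0 (Q * Q) s0.
have m01 := @measurable01 R.
have fabs0 : (\int[mu]_(x in `[0%R, 1%R]) `|(f x)%:E| = 0)%E.
  under eq_integral do rewrite gee0_abs ?lee_fin//.
  have := congr1 EFin f_int0.
  rewrite /int01 /Rintegral fineK; last exact: integrable_fin_num.
  by move=> <-.
have [N [mN N0 fN]] :=
  (ae_eq_integral_abs mu m01 (measurable_int mu intf)).1 fabs0.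
have sub : `]0, 1[ `<=` N `|` [set x : R | root Q x].
  move=> x /=; rewrite in_itv/= => x01.
  have [Qx|Qx] := boolP (root Q x); first by right.
  left; apply: fN => /=; apply/not_implyP; split.
    by rewrite in_itv/=; case/andP: x01 => /ltW -> /ltW ->.
  have fx0 : f x != 0.
    rewrite /f hornerM; apply: mulf_neq0; first exact: mulf_neq0.
    by rewrite gt_eqF// pj_weight_gt0.
  by move=> -[fx]; move: fx0; rewrite /f fx eqxx.
have cQ : countable [set x : R | root Q x].
  exact: finite_set_countable (finite_set_roots Q0).
have mQ : measurable ([set x : R | root Q x] : set (measurableTypeR R)).
  exact: countable_measurable.
have : (mu `]0%R, 1%R[ <= mu N + mu [set x : R | root Q x])%E.
  apply: (le_trans _ (measureU2 _ mN mQ)).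
  by apply: le_measure; rewrite ?inE//; apply: measurableU.
rewrite N0 (countable_lebesgue_measure0 cQ) add0e lebesgue_measure_itv/=.
by rewrite lte_fin ltr01 oppr0 adde0 lee_fin ler10.
Qed.

(** Differentiation under the integral sign: the s-derivative of the integrand is -Q w / x, which
    [pj_weight_div_le1] bounds by C/s. *)
Lemma is_derive_int01_weight (t : R) (Q : {poly R}) : 0 < t ->
  is_derive t 1 (fun s => int01 (fun x => Q.[x] * w s x))
    (- int01 (fun x => Q.[x] * w t x / x)).
Proof.
move=> t0; have [C C0 QC] := horner_bounded01 Q.
have m01 := @measurable01 R.
pose f (s x : R) := Q.[x] * w s x.
have df (s x : R) : is_derive s 1 (f ^~ x) (- (f s x / x)).
  have d1 : is_derive s 1 (fun y : R => - y / x) (- x^-1).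
    have := is_deriveM (is_deriveN (is_derive_id s 1)) (is_derive_cst x^-1 s 1).
    by rewrite /GRing.scale/= mulr0 add0r mulrN1.
  have d2 := @is_derive1_comp R expR _ s _ _ (is_derive_expR _) d1.
  have := is_deriveM (is_derive_cst Q.[x] s 1) (is_deriveM (is_deriveM d2
    (is_derive_cst (x `^ alpha) s 1)) (is_derive_cst ((1 - x) `^ beta) s 1)).
  rewrite /GRing.scale/= => d; apply: is_derive_eq d _.
  by rewrite /f /pj_weight !fctE/=; ring.
have d1f (s x : R) : partial1of2 f s x = - (f s x / x).
  by rewrite partial1of2E; have [_] := df s x.
(* The parameter is restricted to a neighbourhood of [t] bounded away from 0, so that C/s <= C/(t/2)
   gives a dominating constant. *)
have I2 : 0 < t / 2 by rewrite divr_gt0.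
have It : `]t / 2, t + 1[%classic t.
  rewrite /= in_itv/= ltrDl ltr01 andbT ltr_pdivrMr// mulr2n.
  by rewrite mulrDr mulr1 ltrDl.
have Ige s : `]t / 2, t + 1[%classic s -> t / 2 < s.
  by rewrite /= in_itv/= => /andP[].
have intf s : `]t / 2, t + 1[%classic s -> mu.-integrable `[0, 1] (EFin \o f s).
  move=> /Ige ts; apply: integrable_horner_weight => //.
  exact/ltW/(lt_trans I2 ts).
have dersf s x : `]t / 2, t + 1[%classic s -> `[0, 1]%classic x ->
    derivable (f ^~ x) s 1.
  by move=> _ _; have [] := df s x.
pose G := cst (C * (t / 2)^-1) : R -> R.
have G0 x : 0 <= G x by rewrite /G/= mulr_ge0// invr_ge0 ltW.
have intG : mu.-integrable `[0, 1] (EFin \o G).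
  apply: (@integrable01_bounded _ _ (C * (t / 2)^-1)).
    exact: measurable_cst.
  by move=> x _; rewrite ger0_norm.
have GE s x : `]t / 2, t + 1[%classic s -> `[0, 1]%classic x ->
    `|partial1of2 f s x| <= G x.
  move=> /Ige ts; rewrite /= in_itv/= => x01; have s0 := lt_trans I2 ts.
  rewrite d1f normrN /f -mulrA normrM ler_pM ?QC//.
  case/andP: (x01) => x0 _.
  rewrite ger0_norm ?divr_ge0 ?pj_weight_ge0//.
  apply: (@le_trans _ _ s^-1); last by rewrite lef_pV2// ltW.
  rewrite -[leRHS]mulr1 ler_pdivlMl//.
  exact: (pj_weight_div_le1 alpha_gt0 beta_gt0 (ltW s0) x01).
apply: DeriveDef.
  exact: (derivable_under_integral m01 It intf dersf G0 intG GE).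
rewrite -derive1E.
have -> := differentiation_under_integral m01 It intf dersf G0 intG GE.
rewrite -mulN1r /int01 -RintegralZl//.
  by apply: eq_Rintegral => x _; rewrite d1f mulN1r.
(* Since [t > 0], integrability of Q w / x follows by dividing out the factor [t]. *)
have := integrableZl m01 t^-1
  (integrable_horner_weight_div alpha_gt0 beta_gt0 Q (ltW t0)).
by apply: eq_integrable => // x _; rewrite /= -EFinM mulKf// gt_eqF.
Qed.

End weight_integrals.

(** * Algebra of monic sequences under a linear functional *)

Section orthogonal_polynomials.
Context {F : comNzRingType}.
Variables (P : nat -> {poly F}) (h : nat -> F) (L : {poly F} -> F).
Hypothesis P_monic : forall n, P n \is monic.
Hypothesis size_P : forall n, size (P n) = n.+1.
Hypothesis L_linear : forall a p q, L (a *: p + q) = a * L p + L q.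

Lemma monic_seq_coef n : (P n)`_n = 1.
Proof. by have /monicP := P_monic n; rewrite lead_coefE size_P. Qed.

Lemma functional0 : L 0 = 0.
Proof. by have := L_linear (-1) 0 0; rewrite scaler0 addr0 mulN1r addNr. Qed.

Lemma functionalD p q : L (p + q) = L p + L q.
Proof. by have := L_linear 1 p q; rewrite scale1r mul1r. Qed.

Lemma functionalZ a p : L (a *: p) = a * L p.
Proof. by have := L_linear a p 0; rewrite !addr0 functional0 addr0. Qed.

Lemma functional_sum (I : Type) (r : seq I) (f : I -> {poly F}) :
  L (\sum_(i <- r) f i) = \sum_(i <- r) L (f i).
Proof. by apply: (big_morph L functionalD functional0). Qed.

(** The reduction step for expanding a polynomial along the sequence [P]: [P n] is monic of degree
    n, so the coefficient of degree n cancels. *)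
Lemma size_sub_monic_seq n (q : {poly F}) :
  (size q <= n.+1)%N -> (size (q - q`_n *: P n)%R <= n)%N.
Proof.
move=> qn; apply/leq_sizeP => j; rewrite leq_eqVlt coefB coefZ.
case/predU1P => [<-|nj]; first by rewrite monic_seq_coef mulr1 subrr.
rewrite (nth_default _ (leq_trans qn nj)) sub0r.
by rewrite [X in _ * X]nth_default ?size_P// mulr0 oppr0.
Qed.

(** The Gram matrix is C H C^T, where H is the Hankel matrix and the coefficient matrix [C] of the
    [P i] is triangular with unit diagonal, hence of determinant 1. *)
Lemma det_hankel_gram n :
  \det (\matrix_(i < n, j < n) L 'X^(i + j)) =
  \det (\matrix_(i < n, j < n) L (P i * P j)).
Proof.
pose C : 'M[F]_n := \matrix_(i, k) (P i)`_k.
have detC : \det C = 1.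
  rewrite det_trig; first by apply: big1 => i _; rewrite mxE monic_seq_coef.
  by apply/is_trig_mxP => i j ij; rewrite mxE nth_default// size_P.
have PE (i : 'I_n) : P i = \sum_(k < n) (P i)`_k *: 'X^k.
  rewrite -poly_def; apply/polyP => k; rewrite coef_poly.
  by case: ltnP => // nk; rewrite nth_default// size_P (leq_trans _ nk).
have -> : (\matrix_(i < n, j < n) L (P i * P j)) =
    C *m (\matrix_(i < n, j < n) L 'X^(i + j)) *m C^T.
  apply/matrixP => i j; rewrite !mxE {1}(PE i) mulr_suml functional_sum.
  under eq_bigr => k _.
    rewrite {1}(PE j) mulr_sumr functional_sum.
    under eq_bigr => l _ do
      rewrite -scalerAl -scalerAr -exprD !functionalZ mulrCA mulrA.
    over.
  rewrite exchange_big/=; apply: eq_bigr => l _.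
  rewrite !mxE mulr_suml; apply: eq_bigr => k _.
  by rewrite !mxE; ring.
by rewrite !det_mulmx det_tr detC mul1r mulr1.
Qed.

Hypothesis L_orth : forall m n, L (P m * P n) = if m == n then h n else 0.

Lemma orth_lower n (q : {poly F}) : (size q <= n)%N -> L (P n * q) = 0.
Proof.
(* The induction runs on the bound k for the size of [q], with [n] fixed. *)
suff H k : (k <= n)%N ->
    forall q : {poly F}, (size q <= k)%N -> L (P n * q) = 0.
  by move=> qn; exact: (H n).
elim: k => [_ {}q|k IH kn {}q qk].
  by rewrite leqn0 size_poly_eq0 => /eqP ->; rewrite mulr0 functional0.
have qE : q = (q - q`_k *: P k) + q`_k *: P k by rewrite subrK.
rewrite qE mulrDr functionalD (IH (ltnW kn) _ (size_sub_monic_seq qk)) add0r.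
by rewrite -scalerAr functionalZ L_orth gtn_eqF// mulr0.
Qed.

(** Expanding [q] along [P n.+1], [P n] and lower degrees, only the [P n] component survives.
    Removing the [P n.+1] component changes the coefficient of degree n, and this is how p_1(n+1)
    enters. *)
Lemma orth_top n (q : {poly F}) : (size q <= n.+2)%N ->
  L (P n * q) = (q`_n - q`_n.+1 * (P n.+1)`_n) * h n.
Proof.
move=> qn; pose q1 := q - q`_n.+1 *: P n.+1.
have q1n : (size q1 <= n.+1)%N by exact: size_sub_monic_seq.
have qE : q = q1 + q`_n.+1 *: P n.+1 by rewrite subrK.
have q1E : q1 = (q1 - q1`_n *: P n) + q1`_n *: P n by rewrite subrK.
have -> : L (P n * q) = L (P n * q1).
  rewrite {1}qE mulrDr functionalD -scalerAr functionalZ L_orth.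
  by rewrite ltn_eqF// mulr0 addr0.
rewrite {1}q1E mulrDr functionalD (orth_lower (size_sub_monic_seq q1n)) add0r.
by rewrite -scalerAr functionalZ L_orth eqxx /q1 coefB coefZ.
Qed.

End orthogonal_polynomials.

(** * Derivative of a determinant at a diagonal matrix *)

Section derivative_of_determinant.
Context {R : realType}.

Lemma is_derive_bigsum (I : Type) (r : seq I) (f : I -> R -> R) (df : I -> R)
    (x : R) : (forall i, is_derive x 1 (f i) (df i)) ->
  is_derive x 1 (fun s => \sum_(i <- r) f i s) (\sum_(i <- r) df i).
Proof.
move=> fd; elim: r => [|i r IH].
  rewrite big_nil; under [X in is_derive _ _ X]eq_fun do rewrite big_nil.
  exact: is_derive_cst.
rewrite big_cons; under [X in is_derive _ _ X]eq_fun do rewrite big_cons.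
exact: is_deriveD (fd i) IH.
Qed.

Lemma derivable_bigprod (I : Type) (r : seq I) (p : pred I) (f : I -> R -> R)
    (x : R) : (forall i, derivable (f i) x 1) ->
  derivable (fun s => \prod_(i <- r | p i) f i s) x 1.
Proof.
move=> fd; elim: r => [|i r IH].
  under [X in derivable X]eq_fun do rewrite big_nil; exact: derivable_cst.
under [X in derivable X]eq_fun do rewrite big_cons.
by case: (p i) => //; exact: derivableM (fd i) IH.
Qed.

Lemma is_derive_bigprod (I : Type) (r : seq I) (f : I -> R -> R) (df : I -> R)
    (x : R) : (forall i, is_derive x 1 (f i) (df i)) ->
  (forall i, f i x != 0) ->
  is_derive x 1 (fun s => \prod_(i <- r) f i s)
    ((\prod_(i <- r) f i x) * \sum_(i <- r) df i / f i x).
Proof.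
move=> fd f0; elim: r => [|i r IH].
  rewrite !big_nil mulr0; under [X in is_derive _ _ X]eq_fun do rewrite big_nil.
  exact: is_derive_cst.
rewrite !big_cons; under [X in is_derive _ _ X]eq_fun do rewrite big_cons.
have := is_deriveM (fd i) IH; rewrite /GRing.scale/= => d.
apply: is_derive_eq d _; field; exact: f0.
Qed.

(** In the Leibniz expansion a permutation other than the identity moves at least two indices, so
    its term has two factors vanishing at [t] and hence derivative 0. The identity contributes the
    logarithmic derivative of the diagonal product. *)
Lemma is_derive_det_diag n (G : R -> 'M[R]_n) (dG : 'M[R]_n) (t : R) :
  (forall i j, is_derive t 1 (fun s => G s i j) (dG i j)) ->
  (forall i j, i != j -> G t i j = 0) -> (forall i, G t i i != 0) ->
  is_derive t 1 (fun s => \det (G s))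
    ((\prod_i G t i i) * \sum_i dG i i / G t i i).
Proof.
move=> Gd Gdiag G0; set D := (X in is_derive _ _ _ X).
(* [d] assigns the derivative term by term: all of [D] to the identity, 0 elsewhere. *)
pose d (sg : {perm 'I_n}) := if sg == 1%g then D else 0.
have -> : D = \sum_sg d sg.
  rewrite (bigD1 1%g)//= /d eqxx big1 ?addr0// => sg /negbTE -> //.
apply: is_derive_bigsum => sg; rewrite /d.
have [->|sg1] := eqVneq sg 1%g.
  under [X in is_derive _ _ X]eq_fun => s.
    rewrite odd_perm1 expr0 mul1r.
    under eq_bigr => i _ do rewrite perm1.
    over.
  exact: (@is_derive_bigprod _ _ (fun i s => G s i i) (fun i => dG i i)).
have [i sgi] : exists i, sg i != i.
  apply/existsP; apply: contraNT sg1; rewrite negb_exists => /forallP sgE.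
  by apply/eqP/permP => i; rewrite perm1; apply/eqP; rewrite -[_ == _]negbK.
(* By injectivity [sg i] is moved as well, which supplies the second vanishing factor; of the
   remaining product only derivability matters. *)
have sgj : sg (sg i) != sg i by rewrite (inj_eq perm_inj).
pose rest s := \prod_(k | (k != i) && (k != sg i)) G s k (sg k).
have drest : derivable rest t 1.
  by apply: derivable_bigprod => k; have [] := Gd k (sg k).
have dr := derivableP drest.
have -> : (fun s => (-1) ^+ sg * \prod_k G s k (sg k)) =
    (fun s => (-1) ^+ sg * (G s i (sg i) * (G s (sg i) (sg (sg i)) * rest s))).
  by apply/funext => s; rewrite (bigD1 i)//= (bigD1 (sg i))//=.
have := is_deriveM (is_derive_cst ((-1) ^+ sg : R) t 1)
  (is_deriveM (Gd i (sg i)) (is_deriveM (Gd (sg i) (sg (sg i))) dr)).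
rewrite /GRing.scale/= => dd; apply: is_derive_eq dd _.
rewrite !fctE (Gdiag i (sg i)) 1?eq_sym// (Gdiag (sg i)) 1?eq_sym//.
by rewrite !(mul0r, mulr0, addr0).
Qed.

End derivative_of_determinant.

(** * The identities for the Pollaczek-Jacobi weight *)

Section pollaczek_jacobi.
Context {R : realType}.
Variables (alpha beta t : R) (P : nat -> {poly R}) (h : nat -> R).
Hypotheses (alpha_gt0 : 0 < alpha) (beta_gt0 : 0 < beta) (t_ge0 : 0 <= t).
Hypothesis orthP : monic_orthogonal (pj_weight alpha beta t) P h.

Local Notation w := (pj_weight alpha beta).
Local Notation L s Q := (int01 (fun x => Q.[x] * w s x)).

Let P_monic : forall n, P n \is monic. Proof. by case: orthP. Qed.
Let size_P : forall n, size (P n) = n.+1. Proof. by case: orthP. Qed.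

Lemma int01_weight_linear (s : R) : 0 <= s -> forall a (p q : {poly R}),
  L s (a *: p + q) = a * L s p + L s q.
Proof.
move=> s0 a p q.
have ip := integrable_horner_weight alpha_gt0 beta_gt0 p s0.
have iq := integrable_horner_weight alpha_gt0 beta_gt0 q s0.
rewrite -int01Z// -int01D//; last exact: integrable01Z.
by congr int01; apply/funext => x; rewrite hornerD hornerZ mulrDl -(mulrA a).
Qed.

Lemma int01_weight_orth m n : L t (P m * P n) = if m == n then h n else 0.
Proof.
have [_ _ <-] := orthP.
by congr int01; apply/funext => x; rewrite hornerM.
Qed.

Lemma norm_monic_orth_gt0 n : 0 < h n.
Proof.
have := int01_weight_orth n n; rewrite eqxx => <-.
by apply: int01_horner_weight_gt0 => //; rewrite monic_neq0.
Qed.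

Lemma int01_weight_orth_top n (q : {poly R}) : (size q <= n.+2)%N ->
  L t (P n * q) = (q`_n - q`_n.+1 * subleading P n.+1) * h n.
Proof.
exact: (@orth_top _ P h (fun Q => L t Q) P_monic size_P
  (int01_weight_linear t_ge0) int01_weight_orth).
Qed.

(** The [P i] remain those orthogonal at [t], while the weight has the varying parameter [s]. *)
Lemma hankel_det_gram (s : R) n : 0 <= s ->
  hankel_det (w s) n = \det (\matrix_(i < n, j < n) L s (P i * P j)).
Proof.
move=> s0; have := @det_hankel_gram _ P (fun Q => L s Q) P_monic size_P
  (int01_weight_linear s0) n; move=> /= <-.
congr (\det _); apply/matrixP => i j; rewrite !mxE.
by congr int01; apply/funext => x; rewrite hornerXn.
Qed.

Lemma pj_H_sum n : 0 < t ->
  pj_H alpha beta n t =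
  - (t * \sum_(i < n) int01 (fun x => (P i * P i).[x] * w t x / x) / h i).
Proof.
move=> t0; rewrite /pj_H -mulrN; congr (_ * _).
pose G s : 'M[R]_n := \matrix_(i < n, j < n) L s (P i * P j).
pose dG : 'M[R]_n := \matrix_(i < n, j < n)
  - int01 (fun x => (P i * P j).[x] * w t x / x).
have Gd i j : is_derive t 1 (fun s => G s i j) (dG i j).
  rewrite /G mxE; under [X in is_derive _ _ X]eq_fun do rewrite mxE.
  exact: is_derive_int01_weight.
have Gt i j : G t i j = if i == j then h i else 0.
  by rewrite mxE int01_weight_orth -val_eqE; case: eqP => [->|].
have Gdiag i j : i != j -> G t i j = 0 by rewrite Gt => /negbTE ->.
have G0 i : G t i i != 0 by rewrite Gt eqxx gt_eqF ?norm_monic_orth_gt0.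
have detG : \det (G t) = \prod_i G t i i.
  apply: det_trig; apply/is_trig_mxP => i j ij; apply: Gdiag.
  by rewrite -val_eqE/= ltn_eqF.
have prod0 : 0 < \prod_i G t i i.
  by apply: prodr_gt0 => i _; rewrite Gt eqxx norm_monic_orth_gt0.
have dd := is_derive_det_diag Gd Gdiag G0.
have dln : is_derive (\det (G t)) 1 (@ln R) (\det (G t))^-1.
  by apply: is_derive1_ln; rewrite detG.
have [_ dE] := @is_derive1_comp _ _ (fun s => \det (G s)) t _ _ dln dd.
rewrite derive1E.
have -> : 'D_1 (fun s => ln (hankel_det (w s) n)) t =
    'D_1 (@ln R \o (fun s => \det (G s))) t.
  (* The Gram form is available for [s >= 0], which holds near [t] because [t > 0]. *)
  apply: near_eq_derive; near=> s; rewrite /= hankel_det_gram//.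
  by apply: ltW; near: s; exact: lt_nbhsr.
rewrite dE detG mulKf ?gt_eqF// -sumrN; apply: eq_bigr => i _.
by rewrite Gt eqxx mxE mulNr.
Unshelve. all: by end_near. Qed.

Lemma pj_H_step n :
  pj_H alpha beta n t - pj_H alpha beta n.+1 t =
  int01 (fun x => t * ((P n * P n).[x] * w t x / x)) / h n.
Proof.
(* At t = 0 both sides vanish through the factor [t], whatever the value of the derivative in
   [pj_H]. *)
have [t0|t0] := eqVneq t 0.
  rewrite /pj_H t0 !mul0r subrr; under eq_fun do rewrite mul0r.
  by rewrite /int01 Rintegral_cst ?mul0r//; exact: measurable_itv.
have t_gt0 : 0 < t by rewrite lt_neqAle eq_sym t0.
have intJ : (@lebesgue_measure R).-integrable `[0, 1]
    (EFin \o (fun x => (P n * P n).[x] * w t x / x)).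
  have := integrable01Z t^-1
    (integrable_horner_weight_div alpha_gt0 beta_gt0 (P n * P n) t_ge0).
  by congr (_.-integrable _ _); apply/funext => x /=; rewrite mulKf.
rewrite !pj_H_sum// big_ord_recr/= int01Z//; ring.
Qed.

Lemma coefX_deriv (p : {poly R}) k : ('X * p^`())`_k = p`_k *+ k.
Proof. by rewrite coefXM coef_deriv; case: k. Qed.

Lemma coefX_monic_seq n : ('X * P n)`_n = subleading P n.
Proof. by rewrite coefXM; case: n. Qed.

Lemma coefX2_deriv_monic_seq n :
  ('X * ('X * (P n)^`()))`_n = (n%:R - 1) * subleading P n.
Proof.
(* For n = 0 the factor n - 1 is -1, which is harmless since [subleading P 0] is 0. *)
rewrite coefXM; case: n => [|n] /=; first by rewrite mulr0.
have -> : n.+1%:R - 1 = n%:R :> R by rewrite -natr1 addrK.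
by rewrite coefX_deriv mulr_natl.
Qed.

Lemma pj_R_by_parts n :
  beta * int01 (fun x => (P n * P n).[x] * w t x / (1 - x)) =
  int01 (fun x => t * ((P n * P n).[x] * w t x / x))
  + (2 * n%:R + 1 + alpha + beta) * h n.
Proof.
have := int01_by_parts alpha_gt0 beta_gt0 (P n * P n) t_ge0.
(* This cofactor has degree at most n, so only its coefficient 2n + 1 + alpha + beta of degree n
   contributes. *)
set q := (1 + alpha + beta)%:P * P n + 2%:P * ('X * (P n)^`()).
have -> : P n * P n + 'X * (P n * P n)^`() + (alpha + beta) *: (P n * P n) =
    P n * q.
  rewrite /q derivM -mul_polyC !polyCD; ring.
have qE k : q`_k = (1 + alpha + beta) * (P n)`_k + 2 * ((P n)`_k *+ k).
  by rewrite coefD !coefCM coefX_deriv.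
have q0 k : (n < k)%N -> q`_k = 0.
  by move=> nk; rewrite qE nth_default ?size_P// mulr0 mul0rn mulr0 addr0.
rewrite int01_weight_orth_top; last by apply/leq_sizeP => k /ltnW; exact: q0.
rewrite (q0 n.+1)// (qE n) monic_seq_coef//.
move=> /eqP; rewrite subr_eq0 => /eqP <-.
ring.
Qed.

Lemma pj_div_by_parts n :
  int01 (fun x => t * ((P n * P n).[x] * w t x / x)) =
  ((2 * n%:R + alpha + beta) * subleading P n
   - (2 * n%:R + 2 + alpha + beta) * subleading P n.+1
   + t - (2 * n%:R + 1 + alpha)) * h n.
Proof.
have := int01_by_parts alpha_gt0 beta_gt0 ((1 - 'X) * (P n * P n)) t_ge0.
(* This cofactor has degree at most n + 1. Its coefficient of degree n + 1 is -(2n + 2 + alpha +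
   beta), and that of degree n is 2n + 1 + alpha + beta - (2n + alpha + beta) p_1(n). *)
set q := (1 + alpha + beta)%:P * P n - (2 + alpha + beta)%:P * ('X * P n)
  + 2%:P * ('X * (P n)^`()) - 2%:P * ('X * ('X * (P n)^`())).
have -> : (1 - 'X) * (P n * P n) + 'X * ((1 - 'X) * (P n * P n))^`()
    + (alpha + beta) *: ((1 - 'X) * (P n * P n)) = P n * q.
  rewrite /q !derivM derivB derivX -polyC1 derivC -mul_polyC !polyCD; ring.
have qE k : q`_k = (1 + alpha + beta) * (P n)`_k
    - (2 + alpha + beta) * ('X * P n)`_k + 2 * ((P n)`_k *+ k)
    - 2 * ('X * ('X * (P n)^`()))`_k.
  by rewrite !(coefB, coefD) !coefCM coefX_deriv.
have Pn k : (n < k)%N -> (P n)`_k = 0 by move=> nk; rewrite nth_default ?size_P.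
rewrite int01_weight_orth_top; last first.
  apply/leq_sizeP => -[//|k] nk.
  rewrite qE (coefXM (P n)) (coefXM ('X * _)) /= coefX_deriv.
  by rewrite (Pn k)// (Pn k.+1) ?mul0rn ?mulr0 ?subr0 ?addr0// ltnW.
rewrite !qE coefX2_deriv_monic_seq coefX_monic_seq.
rewrite (coefXM (P n)) (coefXM ('X * _)) /= coefX_deriv.
rewrite monic_seq_coef// (Pn n.+1)// !mulr0.
have onemX (x : R) : (1 - 'X).[x] = 1 - x by rewrite !hornerE.
have -> : int01 (fun x => ((1 - 'X) * (P n * P n)).[x] * w t x / (1 - x)) = h n.
  transitivity (L t (P n * P n)); last by rewrite int01_weight_orth eqxx.
  congr int01; apply/funext => x; rewrite hornerM onemX.
  (* At x = 1 the quotient by 1 - x is 0 by convention, and the other side is 0 because the weight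
     vanishes there. *)
  have [->|x1] := eqVneq x 1; first by rewrite pj_weight1// !mulr0 mul0r.
  by field; rewrite subr_eq0 eq_sym.
(* This is (1-x)/x = 1/x - 1, valid at x = 0 too since the weight vanishes there. *)
have -> : int01 (fun x => t * (((1 - 'X) * (P n * P n)).[x] * w t x / x)) =
    int01 (fun x => t * ((P n * P n).[x] * w t x / x)) - t * h n.
  have := int01_weight_orth n n; rewrite eqxx => <-.
  have i1 := integrable_horner_weight alpha_gt0 beta_gt0 (P n * P n) t_ge0.
  rewrite -mulNr -int01Z// -int01D//; last 2 first.
  - exact: integrable_horner_weight_div.
  - exact: integrable01Z.
  congr int01; apply/funext => x; rewrite hornerM onemX.
  have [->|x0] := eqVneq x 0.
    by rewrite pj_weight0// !(mulr0, mul0r) addr0.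
  by field.
move=> E; apply/eqP; rewrite -subr_eq0; apply/eqP; rewrite -[RHS]E.
rewrite mul0rn; ring.
Qed.

End pollaczek_jacobi.

Theorem lemma6p2 (R : realType) (alpha beta t : R)
    (alpha_gt0 : 0 < alpha) (beta_gt0 : 0 < beta) (t_ge0 : 0 <= t)
    (P : nat -> {poly R}) (h : nat -> R)
    (orthP : monic_orthogonal (pj_weight alpha beta t) P h) (n : nat) :
  pj_R alpha beta t P h n =
    pj_H alpha beta n t - pj_H alpha beta n.+1 t + 2 * n%:R + 1 + alpha + beta
  /\
  pj_H alpha beta n t - pj_H alpha beta n.+1 t + 2 * n%:R + 1 + alpha + beta =
    (2 * n%:R + alpha + beta) * subleading P n
    - (2 * n%:R + 2 + alpha + beta) * subleading P n.+1 + t + beta.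
Proof.
have h0 : h n != 0.
  by rewrite gt_eqF// (norm_monic_orth_gt0 alpha_gt0 beta_gt0 t_ge0 orthP).
have stepE := pj_H_step alpha_gt0 beta_gt0 t_ge0 orthP n.
have RE := pj_R_by_parts alpha_gt0 beta_gt0 t_ge0 orthP n.
have KE := pj_div_by_parts alpha_gt0 beta_gt0 t_ge0 orthP n.
(* The term -(2n + 1 + alpha) of [KE] cancels against 2n + 1 + alpha + beta and leaves beta. *)
split; last by rewrite stepE KE mulfK//; ring.
have -> : pj_R alpha beta t P h n =
    beta * int01 (fun x =>
      (P n * P n).[x] * pj_weight alpha beta t x / (1 - x)) / h n.
  rewrite /pj_R mulrAC; congr (_ * _ / _); congr int01.
  by apply/funext => x; rewrite hornerM expr2.
by rewrite RE stepE; field.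
Qed.
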